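(* Let $d\in\mathbb{N}$ and let $f\colon[0,1]\to[0,d]$ be a continuous increasing function with $f(0)>0$. Then there exists a compact set $F\subset\mathbb{R}^d$ such that $\dim_{\mathrm{A}}^{\theta}F\leq f(\theta)$ for all $\theta\in(0,1)$ and $\lim_{\theta\to 1}\dim_{\mathrm{A}}^{\theta}F=f(1)$.
   Context: ''Increasing'' is meant in the non-strict sense. $\mathbb{R}^d$ carries the Euclidean norm and $B(x,\delta)$ is the open ball of centre $x$ and radius $\delta$. For bounded $E\subset\mathbb{R}^d$ and $\delta>0$, $N_\delta(E)$ is the least number of balls of radius $\delta$ required to cover $E$. For $\theta\in(0,1)$ the Assouad spectrum of $F\subset\mathbb{R}^d$ is $$\dim_{\mathrm{A}}^{\theta}F=\inf\Bigl\{\alpha:(\exists C>0)(\forall\, 0<\delta\leq 1)(\forall x\in F)\ N_{\delta^{1/\theta}}(F\cap B(x,\delta))\leq C\Bigl(\frac{\delta}{\delta^{1/\theta}}\Bigr)^{\alpha}\Bigr\}.$$ *)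

(* Defs.v *)
From HB Require Import structures.
From mathcomp Require Import all_boot all_order all_algebra.
From mathcomp Require Import all_classical all_reals all_analysis.

Set Implicit Arguments.
Unset Strict Implicit.
Unset Printing Implicit Defensive.

Import Order.TTheory GRing.Theory Num.Theory.
Import numFieldNormedType.Exports.

Local Open Scope classical_set_scope.
Local Open Scope ring_scope.

(* The norm that MathComp-Analysis puts on ['rV[R]_d] is the sup norm, so the
   Euclidean one is defined here.  Both induce the same topology, and topological
   notions such as [compact] are used on ['rV[R]_d] as they stand. *)
Definition euclidean_norm (R : realType) (d : nat) (x : 'rV[R]_d) : R :=
  Num.sqrt (\sum_(i < d) x 0 i ^+ 2).

Definition euclidean_ball (R : realType) (d : nat) (x : 'rV[R]_d) (r : R) :
    set 'rV[R]_d :=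
  [set y | euclidean_norm (y - x) < r].

(* The centres of the covering balls are arbitrary points of R^d. The value is
   [+oo] exactly when no finite cover exists, which for [0 < r] means that [E]
   is unbounded. *)
Definition covering_number (R : realType) (d : nat) (r : R)
    (E : set 'rV[R]_d) : \bar R :=
  ereal_inf [set n%:R%:E | n in
    [set n : nat | exists c : 'I_n -> 'rV[R]_d,
      E `<=` \bigcup_(i in [set: 'I_n]) euclidean_ball (c i) r]].

(* The exponents [a] range over all of R and the infimum is taken in the
   extended reals, so that the value for [F = set0] is [-oo]. *)
Definition assouad_spectrum (R : realType) (d : nat) (F : set 'rV[R]_d)
    (theta : R) : \bar R :=
  ereal_inf [set a%:E | a in
    [set a : R | exists2 C : R, 0 < C &
      forall delta : R, 0 < delta -> delta <= 1 ->
      forall x : 'rV[R]_d, F x ->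
        (covering_number (delta `^ theta^-1) (F `&` euclidean_ball x delta)
          <= (C * (delta / delta `^ theta^-1) `^ a)%:E)%E]].

(* Main.v *)
Require Import Defs.
From HB Require Import structures.
From mathcomp Require Import all_boot all_order all_algebra.
From mathcomp Require Import all_classical all_reals all_analysis.
From mathcomp Require Import ring lra zify.
Import Order.TTheory GRing.Theory Num.Theory.
Import numFieldNormedType.Exports.
Local Open Scope classical_set_scope.
Local Open Scope ring_scope.

(* Put k = f(0)/d. For integers n and p <= k n let D(n, p) be the set of points of
   R^d whose coordinates have binary digits only at places in [n, n + p) that
   belong to a Beatty-type set of density f(t)/d, where t = 1 - p/(k n). Take for F
   the union of all D(n, p).

   Upper bound: between the scales delta and r = delta^(1/theta) a piece with
   t <= theta branches with exponent f(t) <= f(theta). A piece with t > theta has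
   p < k n (1 - theta), hence at most 2^(d p) <= 2^(f(0) n (1 - theta)) points, which
   is again at most about (delta/r)^f(theta) when 2^-n >= r. Only O(log(1/r)^2)
   pieces have 2^-n >= r; the others lie in one ball about the origin.

   Lower bound: for delta = 2^-m, choosing n = m + O(1) and n + p = m/theta - O(1)
   gives t >= s as soon as 1/theta - 1 <= k (1 - s), and the points of D(n, p) are
   r-separated, so the spectrum at theta is at least f(s). Now let theta, then s,
   tend to 1. *)

(** * Sums of binary digits at prescribed places *)

(* The digit at place [k] has weight [2^-(k+1)]. *)
Fixpoint digit_sums (R : realType) (P : pred nat) (N : nat) : seq R :=
  if N is N'.+1 then
    let s := digit_sums R P N' in
    if P N' then s ++ [seq v + 2^-1 ^+ N | v <- s] else s
  else [:: 0].

Lemma size_digit_sums (R : realType) (P : pred nat) (N : nat) :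
  size (digit_sums R P N) = (2 ^ count P (iota 0 N))%N.
Proof.
elim: N => // N IH; have -> : iota 0 N.+1 = iota 0 N ++ [:: N].
  by rewrite -[in LHS]addn1 iotaD.
rewrite count_cat /= addn0.
by case: (P N); rewrite ?size_cat ?size_map IH /= ?addn0 // addnn -mul2n -expnS addn1.
Qed.

Lemma eq_digit_sums (R : realType) (P Q : pred nat) (N : nat) :
  P =1 Q -> digit_sums R P N = digit_sums R Q N.
Proof. by move=> PQ; elim: N => //= N ->; rewrite PQ. Qed.

Lemma mem0_digit_sums (R : realType) (P : pred nat) (N : nat) :
  0 \in digit_sums R P N.
Proof.
by elim: N => [|N IH] /=; [rewrite inE|case: (P N); rewrite ?mem_cat IH].
Qed.

Lemma digit_sums_split (R : realType) (P Q : pred nat) (N : nat) (v : R) :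
  v \in digit_sums R P N ->
  exists u w, [/\ u \in digit_sums R (predI P Q) N,
    w \in digit_sums R (predD P Q) N & v = u + w].
Proof.
elim: N v => [|N IH] v /=.
  by rewrite inE => /eqP ->; exists 0, 0; rewrite inE eqxx addr0.
rewrite /predI /predD /=; case: (P N) => /=; last by rewrite andbF; exact: IH.
rewrite andbT mem_cat => /orP[/IH[u [w [uP wP ->]]]|/mapP[x /IH[u [w [uP wP ->]]] ->]].
  by exists u, w; split => //; case: (Q N); rewrite /= ?mem_cat ?uP ?wP.
case: (Q N) => /=.
  exists (u + 2^-1 ^+ N.+1), w; split => //; last by rewrite addrAC.
  by rewrite mem_cat; apply/orP; right; apply/mapP; exists u.
exists u, (w + 2^-1 ^+ N.+1); split => //; last by rewrite addrA.
by rewrite mem_cat; apply/orP; right; apply/mapP; exists w.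
Qed.

Lemma digit_sums_ge0 (R : realType) (P : pred nat) (N : nat) (v : R) :
  v \in digit_sums R P N -> 0 <= v.
Proof.
elim: N v => [|N IH] v /=; first by rewrite inE => /eqP ->.
case: (P N) => [|/IH//]; rewrite mem_cat => /orP[/IH//|/mapP[x /IH x0 ->]].
by rewrite addr_ge0 ?exprn_ge0 ?invr_ge0.
Qed.

Lemma digit_sums_small (R : realType) (P : pred nat) (j N : nat) (v : R) :
  {subset P <= leq j} -> v \in digit_sums R P N -> v < 2^-1 ^+ j.
Proof.
move=> Pj vP.
have h0 k : 0 < 2^-1 ^+ k :> R by rewrite exprn_gt0 ?invr_gt0.
(* The geometric sum over the places in [j, N) leaves a gap of 2^-N, and this gap carries the
   induction. Zero is set apart because 2^-N exceeds 2^-j while N < j. *)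
suff : v = 0 \/ v + 2^-1 ^+ N <= 2^-1 ^+ j.
  by case=> [->//|]; apply: lt_le_trans; rewrite ltrDl.
elim: N v vP => [|N IH] v /=; first by rewrite inE => /eqP ->; left.
have half : (2^-1 : R) ^+ N.+1 = 2^-1 * 2^-1 ^+ N by rewrite exprS.
have s0 := h0 N.
case PN : (P N); last by case/IH=> [->|H]; [left|right; lra].
have {PN} jN : (j <= N)%N := Pj _ PN.
have sj : (2^-1 : R) ^+ N <= 2^-1 ^+ j by rewrite ler_wiXn2l ?invr_ge0 ?invf_le1 ?ler1n.
rewrite mem_cat => /orP[/IH[->|H]|/mapP[x /IH[->|H] ->]]; [by left|right..]; lra.
Qed.

Lemma digit_sums_dyadic (R : realType) (P : pred nat) (i N : nat) (v : R) :
  {subset P <= gtn i} -> v \in digit_sums R P N ->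
  exists m : nat, v = m%:R * 2^-1 ^+ i.
Proof.
move=> Pi; elim: N v => [|N IH] v /=.
  by rewrite inE => /eqP ->; exists 0; rewrite mul0r.
case PN : (P N); last exact: IH.
have {PN} iN : (N < i)%N := Pi _ PN.
rewrite mem_cat => /orP[/IH//|/mapP[x /IH[m ->] ->]].
exists (m + 2 ^ (i - N.+1))%N; rewrite natrD mulrDl natrX; congr (_ + _).
rewrite -[X in _ * _ ^+ X](subnK iN) exprD mulrA -exprMn divff ?pnatr_eq0 //.
by rewrite expr1n mul1r.
Qed.

Lemma digit_sums_separated (R : realType) (P : pred nat) (N : nat) (u v : R) :
  u \in digit_sums R P N -> v \in digit_sums R P N -> u != v ->
  2^-1 ^+ N <= `|u - v|.
Proof.
elim: N u v => [|N IH] u v /=.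
  by rewrite !inE => /eqP-> /eqP->; rewrite eqxx.
have h0 : 0 < 2^-1 ^+ N :> R by rewrite exprn_gt0 ?invr_gt0.
have half : (2^-1 : R) ^+ N.+1 = 2^-1 * 2^-1 ^+ N by rewrite exprS.
have le_half : (2^-1 : R) ^+ N.+1 <= 2^-1 ^+ N by lra.
(* A difference that is 0 or at least 2^-N in modulus keeps modulus at least half of 2^-N when
   shifted by that half. *)
have cross x y : x \in digit_sums R P N -> y \in digit_sums R P N ->
    2^-1 ^+ N.+1 <= `|x + 2^-1 ^+ N.+1 - y|.
  move=> xP yP; have [->|xy] := eqVneq x y.
    by rewrite addrAC subrr add0r ger0_norm ?exprn_ge0 ?invr_ge0.
  have := IH _ _ xP yP xy; rewrite !ler_normr => /orP[H|H]; apply/orP; lra.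
case: (P N) => [|uP vP uv]; last exact: le_trans (IH _ _ uP vP uv).
rewrite !mem_cat => /orP[uP|/mapP[x xP ->]] /orP[vP|/mapP[y yP ->]] uv.
- exact: le_trans (IH _ _ uP vP uv).
- by rewrite distrC; apply: cross.
- exact: cross.
- have -> : x + 2^-1 ^+ N.+1 - (y + 2^-1 ^+ N.+1) = x - y by lra.
  by apply: le_trans (IH _ _ xP yP _) => //; apply: contraNneq uv => ->.
Qed.

Lemma uniq_digit_sums (R : realType) (P : pred nat) (N : nat) :
  uniq (digit_sums R P N).
Proof.
elim: N => //= N IH; case: (P N) => //.
have h0 : 0 < 2^-1 ^+ N :> R by rewrite exprn_gt0 ?invr_gt0.
have half : (2^-1 : R) ^+ N.+1 = 2^-1 * 2^-1 ^+ N by rewrite exprS.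
rewrite cat_uniq IH map_inj_uniq ?IH; last exact: addIr.
rewrite andbT /=; apply/hasPn => _ /mapP[x xP ->]; apply/negP => yP.
have := digit_sums_separated _ _ _ _ _ yP xP.
rewrite addrAC subrr add0r ger0_norm; last by lra.
rewrite -subr_eq0 addrAC subrr add0r; lra.
Qed.

(** Digits before place i fix a multiple of 2^-i, and only three multiples are compatible with being
    close to x. Digits at places in [i, j) are free, and those from j on change the value by less
    than 2^-j. *)
Lemma digit_sums_cover (R : realType) (P : pred nat) (N i j : nat) (x : R) :
  exists2 s : seq R,
    (size s <= 3 * 2 ^ count [pred k | P k && (i <= k < j)%N] (iota 0 N))%N &
    forall v, v \in digit_sums R P N -> `|v - x| < 2^-1 ^+ i ->
      exists2 c, c \in s & `|v - c| <= 2^-1 ^+ j.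
Proof.
set P' := [pred k | P k && _]; pose X := Num.floor (x * 2 ^+ i).
exists [seq (X + e%:Z - 1)%:~R * 2^-1 ^+ i + w | e <- iota 0 3, w <- digit_sums R P' N].
  by rewrite size_allpairs size_iota size_digit_sums.
move=> v /(digit_sums_split _ _ (gtn i)) [u [y [uP yP ->]]] vx.
have yi : y < 2^-1 ^+ i.
  by apply: digit_sums_small yP => k; rewrite !inE -leqNgt => /andP[].
move: yP vx yi => /(digit_sums_split _ _ (gtn j))[w [z [wP zP ->]]] vx wz.
have [m um] : exists m : nat, u = m%:R * 2^-1 ^+ i.
  by apply: digit_sums_dyadic uP => k; rewrite !inE => /andP[].
have z0 := digit_sums_ge0 _ _ _ _ zP.
have w0 := digit_sums_ge0 _ _ _ _ wP.
have zj : z < 2^-1 ^+ j.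
  by apply: digit_sums_small zP => k; rewrite !inE -leqNgt => /andP[].
have hi : 0 < 2^-1 ^+ i :> R by rewrite exprn_gt0 ?invr_gt0.
have wP' : w \in digit_sums R P' N.
  rewrite -(eq_digit_sums R (predI (predD P (gtn i)) (gtn j)) P' N) // => k.
  by rewrite /P' /= -leqNgt; case: (P k); case: (i <= k)%N; case: (k < j)%N.
(* Since v = m 2^-i + (w + z) with 0 <= w + z < 2^-i and |v - x| < 2^-i, the integer m lies strictly
   between X - 2 and X + 2. *)
have [e e3 mE] : exists2 e : nat, (e < 3)%N & m = X + e%:Z - 1 :> int.
  have hX : x = x * 2 ^+ i * 2^-1 ^+ i.
    by rewrite -mulrA -exprMn divff ?expr1n ?mulr1 // pnatr_eq0.
  have X1 : X%:~R * 2^-1 ^+ i <= x by rewrite [leRHS]hX ler_pM2r // floor_le.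
  have X2 : x < (X + 1)%:~R * 2^-1 ^+ i by rewrite [ltLHS]hX ltr_pM2r // floorD1_gt.
  move: vx; rewrite um -addrA ltr_norml => /andP[vx1 vx2].
  have lo : X - 2 < m%:Z.
    rewrite -(ltr_int R) -(ltr_pM2r hi) rmorphB /= mulrBl -[m%:~R]/(m%:R); lra.
  have up : m%:Z < X + 2.
    rewrite -(ltr_int R) -(ltr_pM2r hi) rmorphD /= mulrDl -[m%:~R]/(m%:R).
    move: X2; rewrite rmorphD /= mulrDl; lra.
  move: X lo up {X1 X2} => X lo up; clear -lo up.
  exists (absz (m%:Z - X + 1)); lia.
exists (u + w).
  apply/allpairsP; exists (e, w); rewrite mem_iota /= e3; split => //.
  by rewrite um -mE.
have -> : u + (w + z) - (u + w) = z by lra.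
by rewrite ger0_norm // ltW.
Qed.

(** * Beatty sets of digit places *)

(** For 0 <= b <= 1 this set has density b with an error of at most 1 on every interval of places,
    wherever it starts. This uniformity is what a count between two arbitrary scales requires. *)
Definition beatty (R : realType) (b : R) : pred nat :=
  fun k => (Num.truncn (b * k%:R) < Num.truncn (b * k.+1%:R))%N.

(** The floor of b k grows by 0 or 1 at each step because b <= 1, so the count telescopes. *)
Lemma count_beatty (R : realType) (b : R) (i m : nat) : 0 <= b <= 1 ->
  (count (beatty R b) (iota i m) + Num.truncn (b * i%:R) =
   Num.truncn (b * (i + m)%:R))%N.
Proof.
move=> /andP[b0 b1]; elim: m i => [|m IH] i; first by rewrite addn0.
rewrite /= addnS -addSn -IH.
have bi : 0 <= b * i%:R by rewrite mulr_ge0.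
have bi1 : 0 <= b * i.+1%:R by rewrite mulr_ge0.
have : (Num.truncn (b * i%:R) <= Num.truncn (b * i.+1%:R))%N.
  by apply: le_truncn; rewrite ler_wpM2l // ler_nat.
have : (Num.truncn (b * i.+1%:R) <= (Num.truncn (b * i%:R)).+1)%N.
  rewrite truncn_le_nat; have := truncnS_gt (b * i%:R).
  by rewrite -!natr1 mulrDr => ?; lra.
by rewrite {1}/beatty; lia.
Qed.

Lemma count_beatty_bounds (R : realType) (b : R) (i m : nat) : 0 <= b <= 1 ->
  b * m%:R - 1 <= (count (beatty R b) (iota i m))%:R <= b * m%:R + 1.
Proof.
move=> b01; have /andP[b0 b1] := b01.
have /(congr1 (fun n => n%:R : R)) := count_beatty R b i m b01.
have /truncn_itv/andP[h1 h2] : 0 <= b * i%:R by rewrite mulr_ge0.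
have /truncn_itv/andP[h3 h4] : 0 <= b * (i + m)%:R by rewrite mulr_ge0.
move: h2 h3 h4; rewrite -!natr1 !natrD mulrDr => h2 h3 h4 h5.
by apply/andP; split; lra.
Qed.

Lemma count_itv_le (P : pred nat) (i j N : nat) :
  (count [pred k | P k && (i <= k < j)%N] (iota 0 N) <= count P (iota i (j - i)))%N.
Proof.
rewrite -!size_filter; apply: uniq_leq_size; first by rewrite filter_uniq ?iota_uniq.
move=> k; rewrite !mem_filter !mem_iota /= => /andP[/andP[-> /andP[ik kj]] _] /=.
by rewrite ik subnKC // (leq_trans ik (ltnW kj)).
Qed.

Lemma count_tail (P : pred nat) (n p : nat) :
  count [pred k | P k && (n <= k)%N] (iota 0 (n + p)) = count P (iota n p).
Proof.
rewrite iotaD count_cat add0n -[RHS]add0n; congr (_ + _)%N.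
  apply/eqP; rewrite -leqn0 leqNgt -has_count; apply/hasPn => k.
  by rewrite mem_iota /= add0n => kn; rewrite leqNgt kn andbF.
by apply: eq_in_count => k; rewrite mem_iota /= => /andP[-> _]; rewrite andbT.
Qed.

(** * Euclidean norm and finite covers *)

Lemma coord_le_norm (R : realType) (d : nat) (x : 'rV[R]_d) (l : 'I_d) :
  `|x 0 l| <= euclidean_norm x.
Proof.
rewrite -sqrtr_sqr ler_wsqrtr // (bigD1 l) //= lerDl sumr_ge0 // => i _.
exact: sqr_ge0.
Qed.

Lemma norm_le_coord (R : realType) (d : nat) (x : 'rV[R]_d) (rho : R) :
  (forall l, `|x 0 l| <= rho) -> euclidean_norm x <= d%:R * rho.
Proof.
case: d x => [|d] x xr.
  by rewrite /euclidean_norm big_ord0 sqrtr0 mul0r.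
have rho0 : 0 <= rho := le_trans (normr_ge0 _) (xr ord0).
rewrite -(ger0_norm (mulr_ge0 (ler0n R d.+1) rho0)) -sqrtr_sqr ler_wsqrtr //.
apply: (@le_trans _ _ (\sum_(i < d.+1) rho ^+ 2)).
  by apply: ler_sum => i _; rewrite -real_normK ?num_real // lerXn2r ?nnegrE.
rewrite sumr_const card_ord -[_ *+ _]mulr_natl exprMn ler_wpM2r ?sqr_ge0 //.
by rewrite expr2 ler_peMr // ler1n.
Qed.

(** Upper bounds are handled through lists of centres, which can be concatenated; [m] is only a
    bound, so it may be enlarged freely. *)
Definition coverable (R : realType) (d : nat) (r : R) (E : set 'rV[R]_d) (m : nat) :=
  exists2 s : seq 'rV[R]_d, (size s <= m)%N &
    forall y, E y -> exists2 c, c \in s & euclidean_ball c r y.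

Lemma coverable_sub (R : realType) (d : nat) (r : R) (E E' : set 'rV[R]_d) (m m' : nat) :
  E `<=` E' -> (m' <= m)%N -> coverable R d r E' m' -> coverable R d r E m.
Proof.
move=> EE' mm' [s sm' sE']; exists s; first exact: leq_trans mm'.
by move=> y /EE'/sE'.
Qed.

Lemma covering_number_le (R : realType) (d : nat) (r : R) (E : set 'rV[R]_d) (m : nat) :
  coverable R d r E m -> (covering_number r E <= m%:R%:E)%E.
Proof.
move=> [s sm sE]; apply: (@le_trans _ _ (size s)%:R%:E); last first.
  by rewrite lee_fin ler_nat.
apply: ereal_inf_lbound; exists (size s) => //; exists (fun i => nth 0 s i).
move=> y /sE[c cs yc]; have cs' : (index c s < size s)%N by rewrite index_mem.
by exists (Ordinal cs') => //=; rewrite nth_index.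
Qed.

Lemma coverableU (R : realType) (d : nat) (r : R) (E E' : set 'rV[R]_d) (m m' : nat) :
  coverable R d r E m -> coverable R d r E' m' -> coverable R d r (E `|` E') (m + m').
Proof.
move=> [s sm sE] [s' sm' sE']; exists (s ++ s'); first by rewrite size_cat leq_add.
by move=> y [/sE|/sE'] [c cs yc]; exists c; rewrite // mem_cat cs ?orbT.
Qed.

Lemma coverable_bigcup (R : realType) (d : nat) (r : R) (T : eqType) (I : seq T)
    (E : T -> set 'rV[R]_d) (m : nat) :
  (forall i, i \in I -> coverable R d r (E i) m) ->
  coverable R d r (\bigcup_(i in [set` I]) E i) (size I * m).
Proof.
elim: I => [|i I IH] IE; first by exists [::] => // y [].
apply: (@coverable_sub _ _ _ _ (E i `|` \bigcup_(j in [set` I]) E j)) (leqnn _) _.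
  move=> y [j /=]; rewrite inE => /orP[/eqP->|jI]; first by left.
  by right; exists j.
rewrite mulSn; apply: coverableU.
  by apply: IE; rewrite mem_head.
by apply: IH => j jI; apply: IE; rewrite inE jI orbT.
Qed.

Lemma coverable_prod (R : realType) (d : nat) (r rho : R) (E : set 'rV[R]_d)
    (s : 'I_d -> seq R) (m : nat) :
  d%:R * rho < r -> (forall l, (size (s l) <= m)%N) ->
  (forall y, E y -> forall l, exists2 c, c \in s l & `|y 0 l - c| <= rho) ->
  coverable R d r E (m ^ d).
Proof.
move=> rho_r sm sE.
pose c (g : {ffun 'I_d -> 'I_m}) : 'rV[R]_d := \row_l nth 0 (s l) (g l).
exists [seq c g | g : {ffun 'I_d -> 'I_m}].
  by rewrite size_map -cardE card_ffun !card_ord.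
move=> y /sE ys.
have {}ys l : exists k : 'I_m, `|y 0 l - nth 0 (s l) k| <= rho.
  have [a asl ya] := ys l.
  have km : (index a (s l) < m)%N by apply: leq_trans (sm l); rewrite index_mem.
  by exists (Ordinal km); rewrite nth_index.
have [g gP] := choice ys.
exists (c [ffun l => g l]); first by apply/mapP; exists [ffun l => g l]; rewrite ?mem_enum.
apply: le_lt_trans rho_r; apply: norm_le_coord => l.
by rewrite !mxE ffunE.
Qed.

(** * The pieces, their union and its compactness *)

Definition digit_cube (R : realType) (d : nat) (b : R) (n p : nat) : set 'rV[R]_d :=
  [set y | forall l, y 0 l \in
    digit_sums R [pred k | beatty R b k && (n <= k)%N] (n + p)].

Definition digit_union (R : realType) (d : nat) (k : R) (b : nat -> nat -> R) :
    set 'rV[R]_d :=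
  [set y | exists n p : nat, p%:R <= k * n%:R /\ digit_cube R d (b n p) n p y].

Lemma digit_cube_lt (R : realType) (d : nat) (b : R) (n p : nat) (y : 'rV[R]_d) :
  digit_cube R d b n p y -> forall l, `|y 0 l| < 2^-1 ^+ n.
Proof.
move=> yP l; rewrite ger0_norm; last exact: digit_sums_ge0 (yP l).
by apply: digit_sums_small (yP l) => k; rewrite !inE => /andP[].
Qed.

Lemma size_digit_cube (R : realType) (b : R) (n p : nat) :
  size (digit_sums R [pred k | beatty R b k && (n <= k)%N] (n + p)) =
  (2 ^ count (beatty R b) (iota n p))%N.
Proof. by rewrite size_digit_sums count_tail. Qed.

Lemma digit_union0 (R : realType) (d : nat) (k : R) (b : nat -> nat -> R) :
  digit_union R d k b 0.
Proof. by exists 0, 0; rewrite mulr0; split => // l; rewrite mxE mem0_digit_sums. Qed.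

Lemma finite_digit_cube (R : realType) (d : nat) (b : R) (n p : nat) :
  finite_set (digit_cube R d b n p).
Proof.
set s := digit_sums R [pred k | beatty R b k && (n <= k)%N] (n + p).
pose c (g : {ffun 'I_d -> 'I_(size s)}) : 'rV[R]_d := \row_l nth 0 s (g l).
apply: (@sub_finite_set _ _ [set` [seq c g | g : {ffun 'I_d -> 'I_(size s)}]]).
  move=> y yP; have yi (l : 'I_d) : (index (y 0%R l) s < size s)%N by rewrite index_mem yP.
  apply/mapP; exists [ffun l => Ordinal (yi l)]; rewrite ?mem_enum //.
  by apply/rowP => l; rewrite mxE ffunE nth_index // yP.
exact: finite_seq.
Qed.

(* The pieces shrink to the origin, so the union is a finite set together with
   points in an arbitrarily small neighbourhood of the origin. *)
Lemma compact_digit_union (R : realType) (d : nat) (k : R) (b : nat -> nat -> R) :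
  k <= 1 -> compact (digit_union R d k b).
Proof.
(* If [G] clusters at the origin, the origin is the required point. Otherwise a member of [G] misses
   a ball about the origin, and [G] lives on the finitely many pieces with p <= n < j. *)
move=> k1 G PG GF; have [clu0|] := pselect (cluster G (0 : 'rV[R]_d)).
  by exists 0; split => //; exact: digit_union0.
move=> /existsNP[B /existsNP[U /not_implyP[GB /not_implyP[/nbhs_ballP[e /= e0 eU] BU]]]].
have [j je] : exists j : nat, 2^-1 ^+ j < e.
  have : (fun j => 2^-1 ^+ j : R) @ \oo --> (0 : R).
    by apply: cvg_expr; rewrite ger0_norm ?invr_ge0 // invf_lt1 // ltr1n.
  move=> /cvgr_lt/(_ e e0) [j _ jP]; exists j; exact: jP (leqnn j).
pose H : set 'rV[R]_d := \bigcup_(n in `I_j) \bigcup_(p in `I_j)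
  [set y | p%:R <= k * n%:R /\ digit_cube R d (b n p) n p y].
have fH : finite_set H.
  apply: bigcup_finite => [|n _]; first exact: finite_II.
  apply: bigcup_finite => [|p _]; first exact: finite_II.
  by apply: sub_finite_set (finite_digit_cube R d (b n p) n p) => y [].
have GH : G H.
  apply: filterS (filterI GF GB) => y [[n [p [pn yn]]] By].
  have nj : (n < j)%N.
    rewrite ltnNge; apply/negP => jn; apply: BU; exists y; split => //.
    apply: eU; split => // i l; rewrite (ord1 i) mxE /ball /= sub0r normrN.
    apply: lt_trans je; apply: lt_le_trans (digit_cube_lt _ _ _ _ _ _ yn l) _.
    by rewrite ler_wiXn2l ?invr_ge0 ?invf_le1 ?ler1n.
  exists n => //; exists p => //=; apply: leq_ltn_trans nj.
  by rewrite -(ler_nat R); apply: le_trans pn _; rewrite ler_piMl.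
have [y [[n _ [p _ yn]] Gy]] := finite_compact fH PG GH.
by exists y; split => //; exists n, p.
Qed.

(** * Dyadic scales, separated points and a growth estimate *)

Lemma half_expr (R : realType) (k : nat) : 2^-1 ^+ k = 2 `^ (- k%:R) :> R.
Proof. by rewrite powRN powR_mulrn // exprVn. Qed.

(** Shifting by d binary places absorbs the factor d lost in [norm_le_coord]. *)
Lemma dim_half_lt1 (R : realType) (d : nat) : d%:R * 2^-1 ^+ d < 1 :> R.
Proof.
by rewrite exprVn ltr_pdivrMr ?exprn_gt0 // mul1r -natrX ltr_nat ltn_expl.
Qed.

(** Two distinct points of the piece differ in some coordinate by at least 2^-(n+p) >= 2r, so no
    open ball of radius r contains both. Hence choosing a ball for each point is injective. *)
Lemma ge_covering_number_digit_cube (R : realType) (d : nat) (b r : R) (n p : nat)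
    (E : set 'rV[R]_d) :
  digit_cube R d b n p `<=` E -> 2 * r <= 2^-1 ^+ (n + p) ->
  ((2 ^ (count (beatty R b) (iota n p) * d))%N%:R%:E <= covering_number r E)%E.
Proof.
move=> sE r2; apply/ereal_infP => _ [m [c cE] <-]; rewrite lee_fin ler_nat.
rewrite expnM -(size_digit_cube R); set s := digit_sums _ _ _.
pose pt (g : {ffun 'I_d -> 'I_(size s)}) : 'rV[R]_d := \row_l nth 0 s (g l).
have ptE g : exists i, euclidean_ball (c i) r (pt g).
  have /sE/cE[i _ ball_i] : digit_cube R d b n p (pt g).
    by move=> l; rewrite mxE mem_nth.
  by exists i.
have [h hP] := choice ptE.
suff /leq_card : injective h by rewrite card_ffun !card_ord.
move=> g g' hg; apply/ffunP => l; apply/eqP; apply: contraT => gl.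
have : 2^-1 ^+ (n + p) <= `|pt g 0 l - pt g' 0 l|.
  rewrite !mxE; apply: digit_sums_separated; try exact: mem_nth.
  by rewrite nth_uniq // uniq_digit_sums.
have := le_lt_trans (coord_le_norm _ _ _ l) (hP g).
have := le_lt_trans (coord_le_norm _ _ _ l) (hP g').
rewrite hg !mxE !ltr_norml ler_normr => /andP[h1 h2] /andP[h3 h4] /orP[] h5; lra.
Qed.

(** It serves to absorb the number of pieces into an arbitrarily small power of delta/r. It follows
    from 1 + y <= exp y with y = h x ln 2. *)
Lemma linear_le_powR (R : realType) (h c : R) : 0 < h -> 0 <= c ->
  exists2 C : R, 0 < C & forall x, 0 <= x -> x + c <= C * 2 `^ (h * x).
Proof.
move=> h0 c0; have l0 : 0 < ln 2 :> R by rewrite ln_gt0 // ltr1n.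
have hl : 0 < h * ln 2 by rewrite mulr_gt0.
exists (c + (h * ln 2)^-1); first by rewrite ltr_wpDl // invr_gt0.
move=> x x0; apply: (@le_trans _ _ ((c + (h * ln 2)^-1) * (1 + h * x * ln 2))).
  have vx : (h * ln 2)^-1 * (h * x * ln 2) = x by rewrite [h * x * _]mulrAC mulKf ?gt_eqF.
  rewrite mulrDl !mulrDr !mulr1 vx.
  have : 0 <= c * (h * x * ln 2) by rewrite !mulr_ge0 // ltW.
  have : 0 <= (h * ln 2)^-1 by rewrite invr_ge0 ltW.
  by move=> ? ?; lra.
rewrite ler_wpM2l //; first by rewrite addr_ge0 // invr_ge0 ltW.
by rewrite /powR pnatr_eq0 /= expR_ge1Dx.
Qed.

(** * The set [F] and the upper bound *)

Definition spectrum_set (R : realType) (d : nat) (f : R -> R) : set 'rV[R]_d :=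
  let k := f 0 / d%:R in
  digit_union R d k (fun n p => f (1 - p%:R / (k * n%:R)) / d%:R).

Lemma ratio_itv (R : realType) (k : R) (n p : nat) : 0 < k -> p%:R <= k * n%:R ->
  0 <= 1 - p%:R / (k * n%:R) <= 1.
Proof.
move=> k0 pn; have kn : 0 <= k * n%:R := le_trans (ler0n _ _) pn.
rewrite gerBl divr_ge0 // andbT subr_ge0.
(* If k n = 0, the quotient is 0 by the convention on inverses, so t = 1. *)
move: kn; rewrite le_eqVlt => /predU1P[<-|kn]; first by rewrite invr0 mulr0.
by rewrite ler_pdivrMr // mul1r.
Qed.

(* If the weight of the piece exceeds [f theta], the piece has so few levels that
   counting all of its points is enough; otherwise one counts digit choices
   between the levels of [delta] and [r]. *)
Lemma coverable_piece (R : realType) (d : nat) (f : R -> R)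
    (f_range : forall t : R, 0 <= t <= 1 -> 0 <= f t <= d%:R)
    (f_incr : forall s t : R, 0 <= s -> s <= t -> t <= 1 -> f s <= f t)
    (f0_gt0 : 0 < f 0) (d_gt0 : (0 < d)%N)
    (theta M : R) (x : 'rV[R]_d) (n p : nat) :
  0 < theta < 1 -> 0 <= M -> p%:R <= f 0 / d%:R * n%:R ->
  (n < Num.truncn M + d.+1)%N ->
  coverable R d (2 `^ (- M))
    (digit_cube R d (f (1 - p%:R / (f 0 / d%:R * n%:R)) / d%:R) n p
      `&` euclidean_ball x (2 `^ (- (theta * M))))
    (3 ^ d * 2 ^ Num.truncn (f theta * (M - theta * M) + (d * d.+3)%:R)).
Proof.
move=> /andP[theta0 theta1] M0 pn nj.
set t := 1 - _; set b := f t / d%:R; set j := (_ + d.+1)%N in nj *.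
have d0 : 0 < d%:R :> R by rewrite ltr0n.
have k0 : 0 < f 0 / d%:R by rewrite divr_gt0.
have t01 : 0 <= t <= 1 by exact: ratio_itv.
have /andP[ft0 ftd] := f_range _ t01.
have thetaI : 0 <= theta <= 1 by rewrite !ltW.
have /andP[fth0 fthd] := f_range _ thetaI.
have f0th : f 0 <= f theta by apply: f_incr => //; exact: ltW.
have b01 : 0 <= b <= 1 by rewrite divr_ge0 ?ler0n //= ler_pdivrMr // mul1r.
have L0 : 0 <= theta * M by rewrite mulr_ge0 // ltW.
have LM : theta * M <= M by rewrite ler_piMl // ltW.
have /andP[iL Li] := truncn_itv L0; have /andP[jM Mj] := truncn_itv M0.
rewrite -natr1 in Li; rewrite -natr1 in Mj.
have jE : j%:R = (Num.truncn M)%:R + d%:R + 1 :> R by rewrite /j addnS -natr1 natrD.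
(* Here r = 2^-M and delta = 2^-(theta M). Of the d + 1 places beyond the floor of M, one pays for
   the rounding of M and d for the factor d. *)
have rj : d%:R * 2^-1 ^+ j < 2 `^ (- M).
  rewrite /j -addSnnS exprD mulrCA.
  apply: (@lt_le_trans _ _ (2^-1 ^+ (Num.truncn M).+1)).
    by rewrite gtr_pMr ?dim_half_lt1 // exprn_gt0 // invr_gt0.
  by rewrite half_expr ler_powR ?ler1n // lerN2 -natr1 ltW.
have K0 : 0 <= f theta * (M - theta * M) by rewrite mulr_ge0 // subr_ge0.
have bound e : e%:R <= f theta * (M - theta * M) + (d * d.+3)%:R ->
    (2 ^ e <= 2 ^ Num.truncn (f theta * (M - theta * M) + (d * d.+3)%:R))%N.
  by move=> eK; rewrite leq_exp2l // truncn_ge_nat // addr_ge0.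
(* The constant is d (d + 2) + d: rounding adds at most d + 2 places between i and j, each costing
   at most f t <= d, and the Beatty error is 1 in each of d coordinates. *)
have dd : (d * d.+3)%:R = d%:R * d%:R + 3 * d%:R :> R.
  by rewrite -[d.+3]addn3 mulnDr natrD !natrM; lra.
have [tth|tth] := leP t theta.
  have ftth : f t <= f theta by apply: f_incr => //; [case/andP: t01|exact: ltW].
  set i := Num.truncn (theta * M) in iL Li *.
  have ij : (i <= j)%N by rewrite (leq_trans (le_truncn LM)) // leq_addr.
  set c := count (beatty R b) (iota i (j - i)).
  have /choice[s sP] (l : 'I_d) : exists s : seq R, (size s <= 3 * 2 ^ c)%N /\
      forall v, v \in digit_sums R [pred k | beatty R b k && (n <= k)%N] (n + p) ->
      `|v - x 0 l| < 2^-1 ^+ i -> exists2 a, a \in s & `|v - a| <= 2^-1 ^+ j.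
    have [s ss sv] := digit_sums_cover R [pred k | beatty R b k && (n <= k)%N]
      (n + p) i j (x 0 l).
    exists s; split => //; apply: leq_trans ss _; rewrite leq_mul2l leq_exp2l //=.
    apply: leq_trans (count_itv_le _ _ _ _) _.
    by apply: sub_count => k /= /andP[].
  apply: (@coverable_sub _ _ _ _ _ _ ((3 * 2 ^ c) ^ d) (fun y yE => yE)).
    rewrite expnMn -expnM leq_mul2l bound ?orbT // natrM.
    have /andP[_] := count_beatty_bounds R b i (j - i) b01; rewrite -/c natrB // => cb.
    have bd : b * d%:R = f t by rewrite divfK // gt_eqF.
    have : c%:R * d%:R <= (b * (j%:R - i%:R) + 1) * d%:R by rewrite ler_wpM2r.
    have -> : (b * (j%:R - i%:R) + 1) * d%:R = f t * (j%:R - i%:R) + d%:R by rewrite -bd; ring.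
    have : f t * (j%:R - i%:R) <= f t * (M - theta * M + d%:R + 2).
      by apply: ler_wpM2l => //; lra.
    have : f t * (M - theta * M) <= f theta * (M - theta * M).
      by rewrite ler_wpM2r // subr_ge0.
    have : f t * (d%:R + 2) <= d%:R * (d%:R + 2) by rewrite ler_wpM2r // addr_ge0.
    rewrite dd => *; lra.
  apply: (coverable_prod R d _ _ _ s _ rj) => [l|y [yP yx] l].
    by have [] := sP l.
  have [_] := sP l; apply; first exact: yP.
  have := coord_le_norm _ _ (y - x) l; rewrite !mxE => /le_lt_trans -> //.
  apply: lt_le_trans yx _; rewrite half_expr ler_powR ?ler1n // lerN2 //.
have pk : p%:R <= f 0 / d%:R * n%:R * (1 - theta).
  have : 0 <= f 0 / d%:R * n%:R := le_trans (ler0n _ _) pn.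
  rewrite le_eqVlt => /predU1P[kn|kn]; first by move: pn; rewrite -kn mul0r.
  by rewrite mulrC -ler_pdivrMr //; move: tth; rewrite /t; lra.
(* All points of the piece serve as centres. There are at most 2^p values per coordinate, with d p
   <= f(0) (1 - theta) n and n <= M + d + 1. *)
apply: (@coverable_sub _ _ _ _ (digit_cube R d b n p) _ ((2 ^ p) ^ d)).
- by move=> y [].
- rewrite -expnM; apply: leq_trans (bound _ _) _; last by rewrite leq_pmull // expn_gt0.
  have : p%:R * d%:R <= f 0 * (1 - theta) * n%:R.
    rewrite -ler_pdivlMr //; apply: le_trans pk _; rewrite le_eqVlt; apply/orP; left.
    by apply/eqP; field; rewrite gt_eqF.
  have : n%:R <= M + d%:R + 1.
    by apply: (@le_trans _ _ j%:R); [rewrite ler_nat ltnW|rewrite jE; lra].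
  move=> nM pM; rewrite natrM dd; apply: le_trans pM _.
  have : f 0 * (1 - theta) * n%:R <= f 0 * (1 - theta) * (M + d%:R + 1).
    by rewrite ler_wpM2l // mulr_ge0 ?subr_ge0 // ltW.
  have : f 0 * ((1 - theta) * M) <= f theta * ((1 - theta) * M).
    by rewrite ler_wpM2r // mulr_ge0 // subr_ge0 ltW.
  have : f 0 * (1 - theta) <= d%:R * 1.
    by apply: ler_pM; rewrite ?subr_ge0 ?(ltW f0_gt0) ?(ltW theta1) ?(le_trans f0th) //; lra.
  move=> h1 h2; have : f 0 * (1 - theta) * (d%:R + 1) <= d%:R * 1 * (d%:R + 1).
    by rewrite ler_wpM2r // addr_ge0.
  move=> *; nra.
apply: (coverable_prod R d _ _ _
  (fun=> digit_sums R [pred k | beatty R b k && (n <= k)%N] (n + p)) _ rj).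
  by move=> l; rewrite size_digit_cube leq_exp2l // (leq_trans (count_size _ _)) // size_iota.
move=> y yP l; exists (y 0 l) => //.
by rewrite subrr normr0 exprn_ge0 // invr_ge0.
Qed.

(** With j the floor of M plus d + 1, one ball about the origin holds every piece with n >= j. The
    remaining pairs satisfy p <= n < j because k <= 1, so there are at most j^2 of them. *)
Lemma coverable_spectrum_set (R : realType) (d : nat) (f : R -> R)
    (f_range : forall t : R, 0 <= t <= 1 -> 0 <= f t <= d%:R)
    (f_incr : forall s t : R, 0 <= s -> s <= t -> t <= 1 -> f s <= f t)
    (f0_gt0 : 0 < f 0) (d_gt0 : (0 < d)%N) (theta M : R) (x : 'rV[R]_d) :
  0 < theta < 1 -> 0 <= M ->
  coverable R d (2 `^ (- M))
    (spectrum_set R d f `&` euclidean_ball x (2 `^ (- (theta * M))))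
    (1 + (Num.truncn M + d.+1) ^ 2 *
       (3 ^ d * 2 ^ Num.truncn (f theta * (M - theta * M) + (d * d.+3)%:R))).
Proof.
move=> theta01 M0; set j := (_ + d.+1)%N; set B := (3 ^ d * _)%N.
have d0 : 0 < d%:R :> R by rewrite ltr0n.
have M1 := truncnS_gt M.
pose k := f 0 / d%:R; pose b n p := f (1 - p%:R / (k * n%:R)) / d%:R.
have k0 : 0 < k by rewrite divr_gt0.
have k1 : k <= 1.
  by rewrite ler_pdivrMr // mul1r; have /andP[] := f_range 0 (introT andP (conj (lexx 0) ler01)).
pose E (np : nat * nat) := [set y | np.2%:R <= k * np.1%:R /\
  (digit_cube R d (b np.1 np.2) np.1 np.2 `&` euclidean_ball x (2 `^ (- (theta * M)))) y].
pose I := [seq (n, p) | n <- iota 0 j, p <- iota 0 j].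
have -> : (j ^ 2)%N = size I by rewrite size_allpairs !size_iota.
pose E0 : set 'rV[R]_d := [set y | forall l, `|y 0 l| <= 2^-1 ^+ j].
apply: (@coverable_sub _ _ _ _ (E0 `|` \bigcup_(np in [set` I]) E np)) (leqnn _) _.
  move=> y [[n [p [pn yn]]] yx]; have [jn|nj] := leqP j n.
    left => l; apply: le_trans (ltW (digit_cube_lt _ _ _ _ _ _ yn l)) _.
    by rewrite ler_wiXn2l ?invr_ge0 ?invf_le1 ?ler1n.
  right; exists (n, p) => //=; apply/allpairsP; exists (n, p).
  rewrite !mem_iota /= !add0n nj; split => //; apply: leq_ltn_trans nj.
  by rewrite -(ler_nat R); apply: le_trans pn _; rewrite ler_piMl.
apply: coverableU.
  exists [:: 0] => // y yE; exists 0; first by rewrite inE.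
  rewrite /euclidean_ball /= subr0; apply: le_lt_trans (norm_le_coord _ _ _ _ yE) _.
  rewrite /j -addSnnS exprD mulrCA.
  apply: (@lt_le_trans _ _ (2^-1 ^+ (Num.truncn M).+1)).
    by rewrite gtr_pMr ?dim_half_lt1 // exprn_gt0 // invr_gt0.
  by rewrite half_expr ler_powR ?ler1n // lerN2 ltW.
apply: coverable_bigcup => -[n p] /allpairsP[[n' p'] /= []].
rewrite !mem_iota !add0n => /= nj _ [-> ->].
have [pn|pn] := pselect (p'%:R <= k * n'%:R); last by exists [::] => // y [/= /pn].
apply: (@coverable_sub _ _ _ _ _ _ _ _ (leqnn _))
  (coverable_piece R d f f_range f_incr f0_gt0 d_gt0 theta M x n' p' theta01 M0 pn nj).
by move=> y [].
Qed.

Lemma assouad_spectrum_le (R : realType) (d : nat) (f : R -> R)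
    (f_range : forall t : R, 0 <= t <= 1 -> 0 <= f t <= d%:R)
    (f_incr : forall s t : R, 0 <= s -> s <= t -> t <= 1 -> f s <= f t)
    (f0_gt0 : 0 < f 0) (d_gt0 : (0 < d)%N) (theta : R) :
  0 < theta < 1 ->
  (assouad_spectrum (spectrum_set R d f) theta <= (f theta)%:E)%E.
Proof.
move=> theta01; have /andP[theta0 theta1] := theta01.
have /andP[fth0 fthd] : 0 <= f theta <= d%:R by apply: f_range; rewrite !ltW.
apply/lee_addgt0Pr => e e0; apply: ereal_inf_lbound; exists (f theta + e) => //.
(* As delta/r = 2^((1 - theta) M), the square of 2^(h M) is exactly (delta/r)^e; it pays for the
   quadratic number of pieces. *)
pose h := (1 - theta) * e / 2.
have h0 : 0 < h by rewrite divr_gt0 // mulr_gt0 // subr_gt0.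
have [c c0 cP] := linear_le_powR R h (d%:R + 2) h0 (addr_ge0 (ler0n _ _) (ler0n _ _)).
pose K : R := 3 ^+ d * 2 ^+ (d * d.+3).
have K0 : 0 < K by rewrite mulr_gt0 // exprn_gt0.
exists (c ^+ 2 * K); first by rewrite mulr_gt0 // exprn_gt0.
move=> delta delta0 delta1 x _.
pose M := - (ln delta / ln 2) / theta.
have l2 : 0 < ln 2 :> R by rewrite ln_gt0 // ltr1n.
have M0 : 0 <= M.
  rewrite divr_ge0 ?(ltW theta0) // oppr_ge0 pmulr_lle0 ?invr_gt0 //.
  by rewrite ln_le0.
have deltaE : delta = 2 `^ (- (theta * M)).
  rewrite /M mulrCA divff ?gt_eqF // mulr1 opprK /powR pnatr_eq0 /=.
  by rewrite divfK ?gt_eqF // lnK.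
have rE : delta `^ theta^-1 = 2 `^ (- M).
  by rewrite deltaE -powRrM mulNr mulrAC divff ?gt_eqF // mul1r.
have ratioE : delta / delta `^ theta^-1 = 2 `^ (M - theta * M).
  rewrite rE deltaE -powRN opprK -powRD ?(pnatr_eq0, implybT) //.
  by congr (_ `^ _); rewrite addrC.
rewrite ratioE rE deltaE.
apply: le_trans (covering_number_le _ _ _ _ _
  (coverable_spectrum_set R d f f_range f_incr f0_gt0 d_gt0 theta M x theta01 M0)) _.
rewrite lee_fin -powRrM.
set T := Num.truncn _; set U := Num.truncn _.
have TM : T%:R <= M by have /andP[] := truncn_itv M0.
have D0 : 0 <= M - theta * M by rewrite subr_ge0 ler_piMl // ltW.
have U0 : 0 <= f theta * (M - theta * M) + (d * d.+3)%:R by rewrite addr_ge0 // mulr_ge0.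
have UP : 2 ^+ U <= 2 `^ (f theta * (M - theta * M)) * 2 ^+ (d * d.+3) :> R.
  rewrite -!powR_mulrn // -powRD ?(pnatr_eq0, implybT) //.
  by rewrite ler_powR ?ler1n //; have /andP[] := truncn_itv U0.
have -> : (1 + (T + d.+1) ^ 2 * (3 ^ d * 2 ^ U))%N%:R =
    1 + (T%:R + (d%:R + 1)) ^+ 2 * (3 ^+ d * 2 ^+ U) :> R.
  by rewrite natrD natrM natrX natrD natr1 natrM !natrX.
(* Passing from d + 1 to d + 2 absorbs the ball about the origin, by y^2 + 1 <= (y + 1)^2 for y >=
   0. *)
apply: (@le_trans _ _ ((M + (d%:R + 2)) ^+ 2 * (3 ^+ d * 2 ^+ U))).
  have h1 : 1 <= 3 ^+ d * 2 ^+ U :> R by rewrite -!natrX -natrM ler1n muln_gt0 !expn_gt0.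
  have h2 : (T%:R + (d%:R + 1)) ^+ 2 + 1 <= (M + (d%:R + 2)) ^+ 2.
    have a0 : 0 <= T%:R + (d%:R + 1) :> R by rewrite !addr_ge0.
    apply: (@le_trans _ _ ((T%:R + (d%:R + 1) + 1) ^+ 2)).
      by rewrite [leRHS]sqrrD expr1n lerD2r mulr1 lerDl mulrn_wge0.
    have ab : T%:R + (d%:R + 1) + 1 <= M + (d%:R + 2) by clear -TM; lra.
    by rewrite lerXn2r // nnegrE ?addr_ge0.
  apply: le_trans (ler_wpM2r (le_trans ler01 h1) h2).
  by rewrite mulrDl mul1r addrC lerD2l.
have -> : (M - theta * M) * (f theta + e) = f theta * (M - theta * M) + (h * M + h * M).
  by rewrite /h; field.
rewrite powRD ?(pnatr_eq0, implybT) // [X in _ <= _ * (_ * X)]powRD ?(pnatr_eq0, implybT) //.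
have := cP M M0; set P := 2 `^ (h * M) => MP.
set Q := 2 `^ _ in UP *.
have -> : c ^+ 2 * K * (Q * (P * P)) = (c * P) ^+ 2 * (3 ^+ d * (Q * 2 ^+ (d * d.+3))).
  by rewrite /K; ring.
apply: ler_pM.
- by rewrite sqr_ge0.
- by rewrite mulr_ge0 // exprn_ge0.
- by rewrite lerXn2r // nnegrE ?addr_ge0 //; apply: le_trans MP; rewrite !addr_ge0.
- by rewrite ler_wpM2l // exprn_ge0.
Qed.

(** * The lower bound *)

Lemma assouad_spectrum_ge (R : realType) (d : nat) (f : R -> R)
    (f_range : forall t : R, 0 <= t <= 1 -> 0 <= f t <= d%:R)
    (f_incr : forall s t : R, 0 <= s -> s <= t -> t <= 1 -> f s <= f t)
    (f0_gt0 : 0 < f 0) (d_gt0 : (0 < d)%N) (s theta : R) :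
  0 <= s -> 0 < theta < 1 -> theta^-1 - 1 <= f 0 / d%:R * (1 - s) ->
  ((f s)%:E <= assouad_spectrum (spectrum_set R d f) theta)%E.
Proof.
move=> s0 /andP[theta0 theta1] us.
have d0 : 0 < d%:R :> R by rewrite ltr0n.
set k := f 0 / d%:R in us; have k0 : 0 < k by rewrite divr_gt0.
set u := theta^-1 - 1 in us.
have u0 : 0 < u by rewrite subr_gt0 invf_gt1.
have s1 : s <= 1 by rewrite -subr_ge0 -(pmulr_rge0 _ k0) (le_trans (ltW u0)).
have [fs0 fsd] : 0 <= f s /\ f s <= d%:R.
  by apply/andP/f_range; rewrite s0.
apply/ereal_infP => _ [a [C C0 CP] <-]; rewrite lee_fin leNgt; apply/negP => as_.
have l2 : 0 < ln 2 :> R by rewrite ln_gt0 // ltr1n.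
(* With delta = 2^-m one has delta/r = 2^(m u), and the piece will have at least 2^(f(s) m u - K)
   points. In K, d + 2 counts the places lost to rounding and d the Beatty errors. An exponent a <
   f(s) fails once 2^(m u (f(s) - a)) > D, for which m w > D suffices. *)
pose w := u * (f s - a) * ln 2; have w0 : 0 < w by rewrite !mulr_gt0 // subr_gt0.
pose K := f s * (d%:R + 2) + d%:R.
pose D := C * 2 `^ K.
have D0 : 0 < D by rewrite mulr_gt0 // powR_gt0.
pose m := (Num.truncn ((d%:R + 1) / u + D / w)).+1.
have [mu mw] : d%:R + 1 < m%:R * u /\ D < m%:R * w.
  have h1 : 0 <= (d%:R + 1) / u by apply: divr_ge0; [exact: addr_ge0|exact: ltW].
  have h2 : 0 <= D / w by apply: divr_ge0; exact: ltW.
  have := truncnS_gt ((d%:R + 1) / u + D / w); rewrite -/m => h3.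
  by split; rewrite -ltr_pdivrMr //; lra.
have mtheta : m%:R / theta = m%:R + m%:R * u by rewrite /u mulrBr mulr1; lra.
(* One place below the floor of m/theta ensures 2 r <= 2^-q, and d places beyond m put the piece
   inside the ball of radius delta about the origin. The bound m u > d + 1 gives n <= q. *)
pose q := (Num.truncn (m%:R / theta)).-1; pose n := (m + d)%N.
have [qlo qhi] : m%:R / theta - 2 < q%:R /\ q%:R + 1 <= m%:R / theta.
  have mt0 : 0 <= m%:R / theta by rewrite divr_ge0 // ltW.
  have := truncn_itv mt0; rewrite -natr1 /q.
  have : (0 < Num.truncn (m%:R / theta))%N.
    rewrite truncn_ge_nat // mtheta; have := ler0n R m; have := ltW d0; lra.
  by case: (Num.truncn _) => // t _ /andP[]; rewrite -natr1 /=; clear; split; lra.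
have nq : (n <= q)%N.
  rewrite -ltnS -(ltr_nat R) -natr1 /n natrD; move: mu qlo; rewrite mtheta; clear; lra.
pose p := (q - n)%N.
have npq : (n + p)%N = q by rewrite subnKC.
have pE : p%:R = q%:R - m%:R - d%:R :> R by rewrite /p natrB // /n natrD; ring.
have mn : m%:R <= n%:R :> R by rewrite ler_nat leq_addr.
have n0 : 0 < n%:R :> R by rewrite ltr0n addn_gt0 d_gt0 orbT.
(* The hypothesis relating theta and s enters here, through p <= m u <= k n (1 - s); it yields s <=
   t. *)
have pn1 : p%:R <= k * n%:R * (1 - s).
  apply: (@le_trans _ _ (m%:R * u)); first by move: qhi; rewrite pE mtheta; lra.
  rewrite -mulrA [n%:R * _]mulrC mulrA mulrC.
  by apply: ler_pM => //; exact: ltW.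
have pn : p%:R <= k * n%:R.
  by apply: le_trans pn1 _; rewrite ler_piMr ?gerBl // mulr_ge0 ?ltW.
set t := 1 - p%:R / (k * n%:R); have /andP[t0 t1] : 0 <= t <= 1 by exact: ratio_itv.
have st : s <= t by rewrite /t lerBrDr addrC -lerBrDr ler_pdivrMr 1?mulrC //; exact: mulr_gt0.
have fst : f s <= f t by exact: f_incr.
have /andP[ft0 ftd] : 0 <= f t <= d%:R by apply: f_range; rewrite t0.
have b01 : 0 <= f t / d%:R <= 1 by rewrite divr_ge0 // ler_pdivrMr // mul1r.
have := CP (2 `^ (- m%:R)); rewrite powR_gt0 // => /(_ isT).
have -> : 2 `^ (- m%:R) <= 1 :> R by rewrite -half_expr exprn_ile1 ?invr_ge0 ?invf_le1 ?ler1n.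
move=> /(_ isT 0 (digit_union0 _ _ _ _)); apply/negP; rewrite -ltNge.
have rE : (2 `^ (- m%:R)) `^ theta^-1 = 2 `^ (- (m%:R / theta)) :> R.
  by rewrite -powRrM mulNr.
have -> : 2 `^ (- m%:R) / (2 `^ (- m%:R)) `^ theta^-1 = 2 `^ (m%:R * u) :> R.
  rewrite rE -powRN opprK -powRD ?(pnatr_eq0, implybT) //.
  by congr (_ `^ _); rewrite mtheta; ring.
rewrite rE -powRrM.
apply: lt_le_trans (ge_covering_number_digit_cube R d (f t / d%:R) _ n p _ _ _).
- rewrite lte_fin natrX -powR_mulrn //.
  have /andP[cb _] := count_beatty_bounds R (f t / d%:R) n p b01.
  apply: (@lt_le_trans _ _ (2 `^ (f s * (m%:R * u) - K))); last first.
    rewrite ler_powR ?ler1n // natrM.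
    have : (f t / d%:R * p%:R - 1) * d%:R <= (count (beatty R (f t / d%:R)) (iota n p))%:R * d%:R.
      by rewrite ler_wpM2r // ltW.
    have -> : (f t / d%:R * p%:R - 1) * d%:R = f t * p%:R - d%:R by field; rewrite gt_eqF.
    have : f s * p%:R <= f t * p%:R by rewrite ler_wpM2r.
    have : f s * (m%:R * u - (d%:R + 2)) <= f s * p%:R.
      by rewrite ler_wpM2l // pE; move: qlo; rewrite mtheta; lra.
    by rewrite /K => *; lra.
  have -> : f s * (m%:R * u) - K = (m%:R * u * a - K) + m%:R * u * (f s - a) by ring.
  rewrite powRD ?(pnatr_eq0, implybT) // powRD ?(pnatr_eq0, implybT) // powRN.
  rewrite mulrC -mulrA ltr_pM2l ?powR_gt0 // mulrC ltr_pdivlMr ?powR_gt0 // -/D.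
  apply: lt_le_trans mw _; rewrite /powR pnatr_eq0 /=.
  apply: le_trans (expR_ge1Dx _); rewrite ler_wpDl // /w.
  by rewrite !mulrA.
- move=> y yP; split; first by exists n, p.
  rewrite /euclidean_ball /= subr0.
  apply: le_lt_trans (norm_le_coord _ _ _ (2^-1 ^+ n) _) _.
    by move=> l; apply: ltW; exact: digit_cube_lt yP l.
  by rewrite -half_expr /n exprD mulrCA gtr_pMr ?dim_half_lt1 // exprn_gt0 // invr_gt0.
- rewrite npq half_expr -[X in X * _](powRr1 (ler0n R 2)) -powRD ?(pnatr_eq0, implybT) //.
  by rewrite ler_powR ?ler1n //; lra.
Qed.

(** * The limit as theta tends to 1 *)

(** For fixed s < 1 the lower bound f(s) is valid for all t close enough to 1, and f(s) is close to
    f(1) by left continuity. The upper bound f(t) tends to f(1) as well. *)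
Lemma cvg_left_sandwich (R : realType) (f : R -> R) (u : R -> \bar R) (k : R) :
  {within `[0, 1], continuous f} -> 0 < k ->
  (forall t, 0 < t < 1 -> (u t <= (f t)%:E)%E) ->
  (forall s t, 0 <= s -> 0 < t < 1 -> t^-1 - 1 <= k * (1 - s) -> ((f s)%:E <= u t)%E) ->
  u t @[t --> 1^'-] --> (f 1)%:E.
Proof.
move=> /(continuous_within_itvP _ ltr01)[_ _ /cvgrPdist_le f1] k0 uf fu.
have near_f1 e : 0 < e ->
    \forall t \near 1^'-, ((f 1 - e)%:E <= u t <= (f 1 + e)%:E)%E.
  move=> e0.
  have [s [s0 [s1 fs]]] : exists s, 0 < s /\ s < 1 /\ `|f 1 - f s| <= e.
    apply: (@filter_ex _ (1^'- : set_system R)).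
    near=> s; split; [|split]; near: s.
    - exact: nbhs_left_gt.
    - exact: nbhs_left_lt.
    - exact: f1.
  have ks : 0 < k * (1 - s) by rewrite mulr_gt0 // subr_gt0.
  near=> t.
  have t0 : 0 < t by near: t; exact: nbhs_left_gt.
  have t1 : t < 1 by near: t; exact: nbhs_left_lt.
  (* This is the condition 1/t - 1 <= k (1 - s) solved for t. *)
  have zt : (1 + k * (1 - s))^-1 <= t.
    by near: t; apply: nbhs_left_ge; rewrite invf_lt1 ?ltrDl ?addr_gt0.
  have ft : `|f 1 - f t| <= e by near: t; exact: f1.
  move: fs ft; rewrite !ler_norml => /andP[_ fs] /andP[ft _].
  apply/andP; split.
    apply: le_trans (fu s t (ltW s0) _ _); [|by rewrite t0|].
      by rewrite lee_fin; lra.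
    rewrite lerBlDl -(invrK (1 + _)) lef_pV2 // posrE invr_gt0.
    exact: addr_gt0.
  by apply: le_trans (uf t _) _; rewrite ?t0 // lee_fin; lra.
apply/fine_cvgP; split.
  near=> t; have /andP[lo up] : ((f 1 - 1)%:E <= u t <= (f 1 + 1)%:E)%E.
    by near: t; exact: near_f1.
  by rewrite fin_numElt (lt_le_trans (ltNyr _) lo) (le_lt_trans up (ltry _)).
apply/cvgrPdist_le => e e0; near=> t.
have : ((f 1 - e)%:E <= u t <= (f 1 + e)%:E)%E by near: t; exact: near_f1.
rewrite /=; case: (u t) => [v| |] //=; last by rewrite andbC.
by rewrite !lee_fin ler_norml => /andP[? ?]; apply/andP; split; lra.
Unshelve. all: end_near. Qed.

Theorem proposition4p1 (R : realType) (d : nat) (f : R -> R)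
    (f_range : forall t : R, 0 <= t <= 1 -> 0 <= f t <= d%:R)
    (f_cont : {within `[0, 1], continuous f})
    (f_incr : forall s t : R, 0 <= s -> s <= t -> t <= 1 -> f s <= f t)
    (f0_gt0 : 0 < f 0) :
  exists F : set 'rV[R]_d,
    [/\ compact F,
        forall theta : R, 0 < theta < 1 ->
          (assouad_spectrum F theta <= (f theta)%:E)%E &
        assouad_spectrum F theta @[theta --> 1^'-] --> (f 1)%:E].
Proof.
have f0d : f 0 <= d%:R by have /andP[] := f_range 0 (introT andP (conj (lexx 0) ler01)).
have d0 : (0 < d)%N by rewrite -(ltr0n R); exact: lt_le_trans f0d.
have d0R : 0 < d%:R :> R by rewrite ltr0n.
exists (spectrum_set R d f); split.
- by apply: compact_digit_union; rewrite ler_pdivrMr // mul1r.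
- by move=> theta; exact: assouad_spectrum_le.
- apply: (cvg_left_sandwich R f _ (f 0 / d%:R)) => //.
  + exact: divr_gt0.
  + by move=> t; exact: assouad_spectrum_le.
  + by move=> s t; exact: assouad_spectrum_ge.
Qed.
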